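(* Let $V_h^{\pi,\mu}$, $V_h^{\pi}$, $V_h^{*}$ be the safety value functions (defined in the context) of the discrete-time system $x_{t+1}=f(x_t,u_t,a_t)$, $x_t\in\mathcal{S}$, $u_t\in\mathcal{U}$, $a_t\in\mathcal{A}$, with constraint function $h$. Let $x'$ denote the successive state of $x$. Then the following self-consistency conditions hold for every protagonist policy $\pi:\mathcal{S}\to\mathcal{U}$, every adversary policy $\mu:\mathcal{S}\to\mathcal{A}$ and every state $x\in\mathcal{S}$: $$V_h^{\pi,\mu}(x)=\min\left\{h(x),\,V_h^{\pi,\mu}(x')\right\},\qquad x'=f(x,\pi(x),\mu(x)),$$ $$V_h^{\pi}(x)=\min\left\{h(x),\,\min_{a\in\mathcal{A}}\left\{V_h^{\pi}(x')\right\}\right\},\qquad x'=f(x,\pi(x),a),$$ $$V_h^{*}(x)=\min\left\{h(x),\,\max_{u\in\mathcal{U}}\min_{a\in\mathcal{A}}\left\{V_h^{*}(x')\right\}\right\},\qquad x'=f(x,u,a).$$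
   Context: Consider the discrete-time system $x_{t+1}=f(x_t,u_t,a_t)$, where $\mathcal{S}$ is the state space, $\mathcal{U}$ is the action space of control inputs and $\mathcal{A}$ is the action space of external disturbances. The control input follows a policy $\pi:\mathcal{S}\to\mathcal{U}$ (the protagonist) and the disturbance follows a policy $\mu:\mathcal{S}\to\mathcal{A}$ (the adversary). The real-valued constraint function $h$ on $\mathcal{S}$ encodes the safety constraint $h(x)\ge 0$. Let $\{x_t^{\pi,\mu}\}$ denote the state trajectory when the system is driven by $\pi$ and $\mu$, i.e. $x_{t+1}^{\pi,\mu}=f\big(x_t^{\pi,\mu},\pi(x_t^{\pi,\mu}),\mu(x_t^{\pi,\mu})\big)$; $h(x_t^{\pi,\mu}\mid x_0=x)$ denotes the value of $h$ at time $t$ along the trajectory started at $x_0=x$. Here $\mathbb{N}$ includes $0$. The safety value function for a protagonist policy $\pi$ and an adversary policy $\mu$ is $$V_h^{\pi,\mu}(x)=\min_{t\in\mathbb{N}}\left\{h\big(x_t^{\pi,\mu}\mid x_0=x\big)\right\}.$$ The safety value function for a protagonist policy $\pi$ is $$V_h^{\pi}(x)=\min_{\mu(\cdot)}\ \min_{t\in\mathbb{N}}\left\{h\big(x_t^{\pi,\mu}\mid x_0=x\big)\right\}.$$ The optimal safety value function is $$V_h^{*}(x)=\max_{\pi(\cdot)}\ \min_{\mu(\cdot)}\ \min_{t\in\mathbb{N}}\left\{h\big(x_t^{\pi,\mu}\mid x_0=x\big)\right\}.$$ Here $\max_{\pi(\cdot)}$ and $\min_{\mu(\cdot)}$ range over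 policies $\pi:\mathcal{S}\to\mathcal{U}$ and $\mu:\mathcal{S}\to\mathcal{A}$. All minima and maxima written are understood to exist, as the notation implies. *)

(* Defs.v *)
From mathcomp Require Import all_boot all_order all_algebra.
From mathcomp Require Import boolp classical_sets reals.

Set Implicit Arguments.
Unset Strict Implicit.
Unset Printing Implicit Defensive.

Import Order.TTheory GRing.Theory Num.Theory.

Local Open Scope classical_set_scope.
Local Open Scope ring_scope.

Section Extrema.
Context {R : realType} {I : Type}.
Implicit Types F : I -> R.

Definition is_min F (m : R) : Prop := range F m /\ lbound (range F) m.
Definition is_max F (m : R) : Prop := range F m /\ ubound (range F) m.

Definition has_min F : Prop := exists m, is_min F m.
Definition has_max F : Prop := exists m, is_max F m.

(* Attained extrema, not inf/sup; the value is the junk 0 unless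
   [has_min F] (resp. [has_max F]) holds. *)
Definition min_of F : R := xget 0 [set m | is_min F m].
Definition max_of F : R := xget 0 [set m | is_max F m].

End Extrema.

Section SafetyValues.
Context {R : realType} {S U A : Type}.
Variables (f : S -> U -> A -> S) (h : S -> R).

Definition traj (pi : S -> U) (mu : S -> A) (x : S) (t : nat) : S :=
  iter t (fun y => f y (pi y) (mu y)) x.

Definition V_pair (pi : S -> U) (mu : S -> A) (x : S) : R :=
  min_of (fun t : nat => h (traj pi mu x t)).

Definition V_prot (pi : S -> U) (x : S) : R :=
  min_of (fun mu : S -> A => V_pair pi mu x).

Definition V_opt (x : S) : R :=
  max_of (fun pi : S -> U => V_prot pi x).

(* Existence of every extremum occurring in the respective value function,
   nested ones included, at every state. *)
Definition V_pair_exists (pi : S -> U) (mu : S -> A) : Prop :=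
  forall x, has_min (fun t : nat => h (traj pi mu x t)).

Definition V_prot_exists (pi : S -> U) : Prop :=
  (forall mu, V_pair_exists pi mu) /\
  forall x, has_min (fun mu : S -> A => V_pair pi mu x).

Definition V_opt_exists : Prop :=
  (forall pi, V_prot_exists pi) /\
  forall x, has_max (fun pi : S -> U => V_prot pi x).

End SafetyValues.

(* Main.v *)
(* Each value function is characterised by its superlevel sets: c <= V_h^pi(x)
   iff no trajectory from x under pi, against any stationary adversary, goes
   below c.  The two inequalities where stationarity of the policies matters are
   obtained as follows.
   - Adversary: to play a at x and mu afterwards, modify mu at x only.  This
     does not affect the trajectory of mu from x' until it visits x; if it does
     visit x, the rest of it is a trajectory of mu itself from x.
   - Protagonist: the optimal policies depend on the initial state.  They are
     glued as follows.  Let K be the set of states y with c <= h(y) at which some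
     action u guarantees c <= V_h^*(f(y,u,a)) for all a.  A policy playing such
     an action at each y in K keeps K invariant, since {c <= V_h^*} is included
     in K by taking for u the first action of a policy optimal from y. *)
Require Import Defs.
From mathcomp Require Import all_boot all_order all_algebra.
From mathcomp Require Import boolp classical_sets reals.

Import Order.TTheory GRing.Theory Num.Theory.

Local Open Scope ring_scope.

Section Extrema.
Context {R : realType} {I : Type}.
Implicit Types F : I -> R.

Lemma min_ofP F : has_min F -> is_min F (min_of F).
Proof. by move=> [m Fm]; exact: (@xgetPex _ 0 [set m | is_min F m]) (ex_intro _ m Fm). Qed.

Lemma max_ofP F : has_max F -> is_max F (max_of F).
Proof. by move=> [m Fm]; exact: (@xgetPex _ 0 [set m | is_max F m]) (ex_intro _ m Fm). Qed.

Lemma le_min_ofP F c : has_min F -> (c <= min_of F <-> forall i, c <= F i).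
Proof.
move=> /min_ofP[[i _ <-] lbF]; split=> [cF j | ]; last exact.
by apply: le_trans cF _; apply: lbF; exists j.
Qed.

Lemma le_max_of {F} i : has_max F -> F i <= max_of F.
Proof. by move=> /max_ofP[_]; apply; exists i. Qed.

Lemma max_of_attained {F} : has_max F -> exists i, F i = max_of F.
Proof. by move=> /max_ofP[[i _ Fi] _]; exists i. Qed.

End Extrema.

Lemma le_ext (R : realType) (v w : R) :
  (forall c, c <= v <-> c <= w) -> v = w.
Proof.
move=> vw; apply/eqP; rewrite eq_le.
by apply/andP; split; [apply/(vw v) | apply/(vw w)].
Qed.

Section SafetyValues.
Context {R : realType} {S U A : Type}.
Variables (f : S -> U -> A -> S) (h : S -> R).
Implicit Types (pi : S -> U) (mu : S -> A) (x y : S) (c : R).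

Lemma trajS pi mu x t :
  traj f pi mu x t.+1 = traj f pi mu (f x (pi x) (mu x)) t.
Proof. by rewrite /traj iterSr. Qed.

Lemma trajD pi mu x s t :
  traj f pi mu x (s + t) = traj f pi mu (traj f pi mu x t) s.
Proof. by rewrite /traj iterD. Qed.

(** The state at time [t] is determined by the actions at times before [t], so a visit to [x] at
    time [t] itself is harmless. *)
Lemma traj_eq_off pi mu mu' x y t :
    (forall z, z <> x -> mu' z = mu z) ->
    (forall s, (s < t)%N -> traj f pi mu y s <> x) ->
  traj f pi mu' y t = traj f pi mu y t.
Proof.
move=> mu'E; elim: t => [//|t IHt] yx /=.
have yt : traj f pi mu' y t = traj f pi mu y t.
  by apply: IHt => s st; apply: yx; apply: ltnW.
by rewrite /traj /= -!/(traj _ _ _ _ _) yt mu'E //; apply: yx.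
Qed.

Lemma traj_invariant (P : S -> Prop) pi mu x t :
    (forall y, P y -> P (f y (pi y) (mu y))) -> P x -> P (traj f pi mu x t).
Proof. by move=> Pf Px; elim: t => //= t; apply: Pf. Qed.

Lemma le_V_pairP pi mu x c : V_pair_exists f h pi mu ->
  c <= V_pair f h pi mu x <-> forall t, c <= h (traj f pi mu x t).
Proof. by move=> ex; apply: le_min_ofP. Qed.

Lemma le_V_protP pi x c : V_prot_exists f h pi ->
  c <= V_prot f h pi x <-> forall mu t, c <= h (traj f pi mu x t).
Proof.
move=> [ex1 ex2]; rewrite le_min_ofP //; split=> cV mu;
  by apply/le_V_pairP.
Qed.

Lemma V_pair_step pi mu x : V_pair_exists f h pi mu ->
  V_pair f h pi mu x
    = Num.min (h x) (V_pair f h pi mu (f x (pi x) (mu x))).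
Proof.
move=> ex; apply: le_ext => c; rewrite le_min; split=> [/le_V_pairP cV | ].
  apply/andP; split; first exact: (cV ex 0%N).
  by apply/le_V_pairP => // t; rewrite -trajS; apply: cV.
move=> /andP[chx /le_V_pairP cV]; apply/le_V_pairP => // -[//|t].
by rewrite trajS; apply: cV.
Qed.

Lemma le_V_prot_step pi x c : V_prot_exists f h pi ->
  c <= V_prot f h pi x <->
  c <= h x /\ forall a, c <= V_prot f h pi (f x (pi x) a).
Proof.
move=> ex; rewrite le_V_protP //; split=> [cx | [chx cV] mu [//|t]]; last first.
  by rewrite trajS; have /le_V_protP := cV (mu x); apply.
(* [A] is not assumed inhabited; the attained minimum over adversaries supplies one, and its time 0
   bounds [h x]. *)
have [mu0 _] : exists mu : S -> A, True.
  by have [_ /(_ x)[m [[mu _ _] _]]] := ex; exists mu.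
split=> [|a]; first exact: (cx mu0 0%N).
apply/le_V_protP => // mu t.
have [[s [st sx]] | nx] := pselect (exists s, (s <= t)%N /\
    traj f pi mu (f x (pi x) a) s = x).
  (* After the visit at time [s], the remaining [t - s] steps start at [x], where [cx] applies to
     [mu]. *)
  by rewrite -(subnK st) trajD sx.
pose mu' z := if pselect (z = x) then a else mu z.
have mu'x : mu' x = a by rewrite /mu'; case: pselect.
have <- : traj f pi mu' (f x (pi x) a) t = traj f pi mu (f x (pi x) a) t.
  apply: (@traj_eq_off _ _ _ x) => [z zx | s st sx].
    by rewrite /mu'; case: pselect.
  by apply: nx; exists s; split=> //; apply: ltnW.
by rewrite -[in f x _ _]mu'x -trajS.
Qed.

(** Attainment over [a] is a separate hypothesis: when [h x] is the smaller term, the values at the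
    successors may have an unattained infimum. *)
Lemma V_prot_step pi x : V_prot_exists f h pi ->
    has_min (fun a => V_prot f h pi (f x (pi x) a)) ->
  V_prot f h pi x
    = Num.min (h x) (min_of (fun a => V_prot f h pi (f x (pi x) a))).
Proof.
move=> ex exa; apply: le_ext => c; rewrite le_V_prot_step // le_min.
split=> [[-> cV] | /andP[-> cV]]; last by split=> //; apply/le_min_ofP.
exact/le_min_ofP.
Qed.

Lemma le_V_opt_action x c : V_opt_exists f h -> c <= V_opt f h x ->
  c <= h x /\ exists u, forall a, c <= V_opt f h (f x u a).
Proof.
move=> [ex1 ex2].
have [pi piE] : exists pi, V_prot f h pi x = V_opt f h x.
  exact: max_of_attained (ex2 x).
rewrite -piE => /le_V_prot_step[//|chx cV]; split=> //; exists (pi x) => a.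
(* [pi] need not be optimal from the successor; its value there is still at most [V_opt]. *)
exact: le_trans (cV a) (le_max_of pi (ex2 _)).
Qed.

Lemma le_V_opt_step x c : V_opt_exists f h ->
  c <= V_opt f h x <->
  c <= h x /\ exists u, forall a, c <= V_opt f h (f x u a).
Proof.
move=> ex; split=> [|[chx [u cu]]]; first exact: le_V_opt_action.
have [ex1 ex2] := ex.
pose K y := c <= h y /\ exists v, forall a, c <= V_opt f h (f y v a).
have /choice[pi piK] y : exists v, K y -> forall a, c <= V_opt f h (f y v a).
  (* Outside [K] the action is arbitrary; [u] only serves as an element of [U]. *)
  by have [[_ [v cv]] | nK] := pselect (K y); [exists v | exists u].
apply: le_trans (le_max_of pi (ex2 x)).
apply/le_V_protP => // mu t.
suff [] : K (traj f pi mu x t) by [].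
apply: traj_invariant => [y /piK cV|]; last by split=> //; exists u.
exact: le_V_opt_action.
Qed.

Lemma V_opt_step x : V_opt_exists f h ->
    (forall u, has_min (fun a => V_opt f h (f x u a))) ->
    has_max (fun u => min_of (fun a => V_opt f h (f x u a))) ->
  V_opt f h x
    = Num.min (h x) (max_of (fun u => min_of (fun a => V_opt f h (f x u a)))).
Proof.
move=> ex exa exu; apply: le_ext => c; rewrite le_V_opt_step // le_min.
split=> [[-> [u cu]] | /andP[-> cV]].
  by apply: le_trans (le_max_of u exu); apply/le_min_ofP.
(* A maximizing action serves every level [c] below the maximum. *)
split=> //; have [u uE] := max_of_attained exu.
by exists u; apply/le_min_ofP; rewrite // uE.
Qed.

End SafetyValues.

Theorem theorem1 (R : realType) (S U A : Type)
    (f : S -> U -> A -> S) (h : S -> R) :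
  (forall (pi : S -> U) (mu : S -> A) (x : S),
     V_pair_exists f h pi mu ->
     V_pair f h pi mu x
       = Num.min (h x) (V_pair f h pi mu (f x (pi x) (mu x))))
  /\
  (forall (pi : S -> U) (x : S),
     V_prot_exists f h pi ->
     has_min (fun a : A => V_prot f h pi (f x (pi x) a)) ->
     V_prot f h pi x
       = Num.min (h x) (min_of (fun a : A => V_prot f h pi (f x (pi x) a))))
  /\
  (forall x : S,
     V_opt_exists f h ->
     (forall u : U, has_min (fun a : A => V_opt f h (f x u a))) ->
     has_max (fun u : U => min_of (fun a : A => V_opt f h (f x u a))) ->
     V_opt f h x
       = Num.min (h x)
           (max_of (fun u : U => min_of (fun a : A => V_opt f h (f x u a))))).
Proof.
split; [|split].
- by move=> pi mu x; apply: V_pair_step.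
- by move=> pi x; apply: V_prot_step.
- by move=> x; apply: V_opt_step.
Qed.
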